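(* Let $G$ be a simple directed graph with proper edge coloring. Then the associated 2-step nilpotent Lie algebra $\mathfrak{n}_G$ has no abelian factor.
   Context: A directed edge-labeled graph $G=(V,E,C)$ is a finite connected directed graph with vertex set $V=\{v_1,\dots,v_n\}$ and edge set $E$, together with a surjective labeling $c:E\to C=\{Z_1,\dots,Z_p\}$, $p\ge1$ (labels may be repeated on different edges; in particular there is at least one edge). Edge colors are the same as edge labels. Simple means no loops and at most one edge between any two distinct vertices. An edge coloring is proper if no two incident edges have the same color. The Lie algebra $\mathfrak{n}_G$: as a real vector space $\mathfrak{n}_G=\mathfrak{v}\oplus\mathfrak{w}$, where $\mathfrak{v}$ has basis $V$ and $\mathfrak{w}$ has basis $C$. The bracket is bilinear and skew-symmetric with $[v_i,v_j]=\sum_{\ell}(\epsilon_\ell-\epsilon'_\ell)Z_\ell$, where $\epsilon_\ell=1$ if $c(v_i,v_j)=Z_\ell$ and $0$ otherwise, and $\epsilon'_\ell=1$ if $c(v_j,v_i)=Z_\ell$ and $0$ otherwise, $(v,w)$ denoting an edge directed from $v$ to $w$; all other brackets of basis elements are zero. The derived algebra is $[\mathfrak{n}_G,\mathfrak{n}_G]=\mathfrak{w}$. The abelian factor of $\mathfrak{n}_G$ is the unique subspace $\mathfrak{a}\subseteq\mathfrak{v}$ such that the center satisfies $\mathcal{Z}(\mathfrak{n}_G)=[\mathfrak{n}_G,\mathfrak{n}_G]\oplus\mathfrak{a}$; $\mathfrak{n}_G$ has no abelian factor if $\mathfrak{a}=\{0\}$. *)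

(* Defs.v *)
From HB Require Import structures.
From mathcomp Require Import all_boot all_order all_algebra reals.

Set Implicit Arguments.
Unset Strict Implicit.
Unset Printing Implicit Defensive.

Import GRing.Theory.
Local Open Scope ring_scope.

HB.mixin Record Vector_isLieAlgebra (R : fieldType) L of Vector R L := {
  lie : L -> L -> L;
  lie_linear_l : forall y, linear (lie^~ y);
  lie_linear_r : forall x, linear (lie x);
  liexx : forall x, lie x x = 0;
  lie_jacobi : forall x y z,
    lie x (lie y z) + lie y (lie z x) + lie z (lie x y) = 0
}.

#[short(type="lieAlgType")]
HB.structure Definition LieAlgebra (R : fieldType) :=
  {L of Vector_isLieAlgebra R L & Vector R L}.

Section LieTheory.
Variables (R : fieldType) (L : lieAlgType R).
Implicit Types (x y : L) (U : {vspace L}).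

Definition lie_left y : L -> L := lie^~ y.
HB.instance Definition _ y :=
  GRing.isLinear.Build R L L *:%R (lie_left y) (lie_linear_l y).

Definition lie_right x : L -> L := lie x.
HB.instance Definition _ x :=
  GRing.isLinear.Build R L L *:%R (lie_right x) (lie_linear_r x).

Definition ad x : 'End(L) := linfun (lie_right x).

Fact ad_linear : linear ad.
Proof.
move=> a x y; apply/lfunP => z.
by rewrite add_lfunE scale_lfunE !lfunE /= /lie_right (lie_linear_l z).
Qed.
HB.instance Definition _ := GRing.isLinear.Build R L 'End(L) *:%R ad ad_linear.

Definition center : {vspace L} := lker (linfun ad).

Lemma centerP x : reflect (forall y, lie x y = 0) (x \in center).
Proof.
rewrite memv_ker lfunE /=; apply: (iffP eqP) => [x0 y | x0].
  by have /lfunP/(_ y) := x0; rewrite !lfunE.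
by apply/lfunP => y; rewrite !lfunE /= /lie_right x0.
Qed.

(* As for prodv on associative algebras, brackets of basis vectors are enough:
   derivedP states that this is the span of all brackets. *)
Definition derived : {vspace L} :=
  <<[seq lie x y | x <- vbasis {:L}, y <- vbasis {:L}]>>%VS.

Lemma derivedP U : reflect (forall x y, lie x y \in U) (derived <= U)%VS.
Proof.
apply: (iffP span_subvP) => [sU x y | sU _ /allpairsP[[x y] [_ _ ->]]]; last first.
  exact: sU.
rewrite (coord_vbasis (memvf y)) -/(lie_right x _) linear_sum.
apply: memv_suml => j _; rewrite linearZ memvZ //= /lie_right.
rewrite (coord_vbasis (memvf x)) -/(lie_left _ _) linear_sum.
apply: memv_suml => i _; rewrite linearZ memvZ //= /lie_left.
by rewrite sU // allpairs_f // mem_nth // size_tuple.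
Qed.

End LieTheory.

(* Edges are a type of their own, so that loops and repeated edges are possible
   before assuming simplicity; joins and connectedness ignore orientation. *)
Record edge_labeled_digraph := EdgeLabeledDigraph {
  vert : finType;
  edge : finType;
  label : finType;
  src : edge -> vert;
  tgt : edge -> vert;
  color : edge -> label;
  joins : edge -> rel vert := fun e v w =>
    (src e == v) && (tgt e == w) || (src e == w) && (tgt e == v);
  digraph_connected :
    forall v w, connect [rel v w | [exists e, joins e v w]] v w;
  color_surj : forall z, exists e, color e = z;
  label_gt0 : (0 < #|label|)%N
}.

Section Graph.
Variable G : edge_labeled_digraph.
Implicit Types (v w : vert G) (e f : edge G).

Definition simple_digraph :=
  (forall e, src e != tgt e) /\
  (forall v w, v != w -> forall e f, joins e v w -> joins f v w -> e = f).

Definition endpoint v e := (v == src e) || (v == tgt e).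

Definition incident e f := [exists v, endpoint v e && endpoint v f].

Definition proper_coloring :=
  forall e f, e != f -> incident e f -> color e != color f.

End Graph.

Section GraphLieAlgebra.
Variables (R : realType) (G : edge_labeled_digraph).

(* First component: coordinates on the vertices (the space v);
   second component: coordinates on the labels (the space w). *)
Definition graph_lie : Type := {ffun vert G -> R^o} * {ffun label G -> R^o}.
HB.instance Definition _ := Vector.on graph_lie.

Definition vert_vec (v : vert G) : graph_lie := ([ffun w => (w == v)%:R], 0).
Definition label_vec (z : label G) : graph_lie := (0, [ffun t => (t == z)%:R]).

Definition has_edge (v w : vert G) (z : label G) : bool :=
  [exists e, [&& src e == v, tgt e == w & color e == z]].

Definition basis_bracket (v w : vert G) : graph_lie :=
  \sum_z ((has_edge v w z)%:R - (has_edge w v z)%:R) *: label_vec z.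

Definition graph_bracket (x y : graph_lie) : graph_lie :=
  \sum_v \sum_w (x.1 v * y.1 w) *: basis_bracket v w.

Fact graph_bracket_linear_l y : linear (graph_bracket^~ y).
Proof.
move=> a x x'; rewrite /graph_bracket scaler_sumr -big_split; apply: eq_bigr => v _.
rewrite scaler_sumr -big_split; apply: eq_bigr => w _ /=.
by rewrite !ffunE scalerA -scalerDl mulrA -mulrDl.
Qed.

Fact graph_bracket_linear_r x : linear (graph_bracket x).
Proof.
move=> a y y'; rewrite /graph_bracket scaler_sumr -big_split; apply: eq_bigr => v _.
rewrite scaler_sumr -big_split; apply: eq_bigr => w _ /=.
by rewrite !ffunE scalerA -scalerDl mulrCA -mulrDr.
Qed.

Fact basis_bracketC v w : basis_bracket v w = - basis_bracket w v.
Proof.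
by rewrite /basis_bracket -sumrN; apply: eq_bigr => z _; rewrite -scaleNr opprB.
Qed.

Fact graph_bracketC x y : graph_bracket x y = - graph_bracket y x.
Proof.
rewrite /graph_bracket exchange_big -sumrN; apply: eq_bigr => v _.
rewrite -sumrN; apply: eq_bigr => w _.
by rewrite basis_bracketC scalerN mulrC.
Qed.

Fact graph_bracketxx x : graph_bracket x x = 0.
Proof.
have /eqP := graph_bracketC x x; rewrite -addr_eq0 -mulr2n -scaler_nat scaler_eq0.
by rewrite Num.Theory.pnatr_eq0 => /eqP.
Qed.

Fact basis_bracket1 v w : (basis_bracket v w).1 = 0.
Proof.
rewrite /basis_bracket (raddf_sum fst) big1 // => z _.
by rewrite /= scaler0.
Qed.

Fact graph_bracket1 x y : (graph_bracket x y).1 = 0.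
Proof.
rewrite /graph_bracket (raddf_sum fst) big1 // => v _.
rewrite (raddf_sum fst) big1 // => w _.
by rewrite /= basis_bracket1 scaler0.
Qed.

Fact graph_bracket2step x y z : graph_bracket x (graph_bracket y z) = 0.
Proof.
rewrite {1}/graph_bracket; apply: big1 => v _; apply: big1 => w _.
by rewrite graph_bracket1 ffunE mulr0 scale0r.
Qed.

Fact graph_bracket_jacobi x y z :
  graph_bracket x (graph_bracket y z) + graph_bracket y (graph_bracket z x)
    + graph_bracket z (graph_bracket x y) = 0.
Proof. by rewrite !graph_bracket2step !addr0. Qed.

HB.instance Definition _ := Vector_isLieAlgebra.Build R graph_lie
  graph_bracket_linear_l graph_bracket_linear_r
  graph_bracketxx graph_bracket_jacobi.

Lemma graph_lieE (x y : graph_lie) : lie x y = graph_bracket x y.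
Proof. by []. Qed.

Lemma lie_vert_vec v w : lie (vert_vec v) (vert_vec w) = basis_bracket v w.
Proof.
rewrite graph_lieE /graph_bracket (bigD1 v) //= (bigD1 w) //= !ffunE !eqxx mulr1 scale1r.
rewrite !big1 ?addr0 // => i ni.
  by rewrite big1 // => j _; rewrite !ffunE (negPf ni) mul0r scale0r.
by rewrite !ffunE (negPf ni) mulr0 scale0r.
Qed.

Lemma lie_label_vecl z x : lie (label_vec z) x = 0.
Proof.
rewrite graph_lieE /graph_bracket; apply: big1 => v _; apply: big1 => w _.
by rewrite ffunE mul0r scale0r.
Qed.

Lemma lie_label_vecr z x : lie x (label_vec z) = 0.
Proof. by rewrite graph_lieE graph_bracketC -graph_lieE lie_label_vecl oppr0. Qed.

Definition vert_space : {vspace graph_lie} := <<[seq vert_vec v | v : vert G]>>%VS.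

Definition is_abelian_factor (a : {vspace graph_lie}) : Prop :=
  [/\ (a <= vert_space)%VS,
      center graph_lie = (derived graph_lie + a)%VS
    & directv (derived graph_lie + a)].

Definition no_abelian_factor : Prop := unique is_abelian_factor 0%VS.

End GraphLieAlgebra.

(* Main.v *)
Require Import Defs.
From HB Require Import structures.
From mathcomp Require Import all_boot all_order all_algebra reals.

(** The theorem says that the center and the derived algebra coincide: an
    abelian factor is then contained in the derived algebra, which it meets
    trivially.

    Brackets have no vertex component and label vectors are central, so the
    derived algebra lies in the center.  Conversely, let [x] be central and
    [v] a vertex.  The graph is connected and its edges are not loops, so [v]
    is joined to some [w] by an edge [e].  Properness makes [e] the only edge
    of its color at [w], so the coordinate of the bracket of [x] and [w] along
    that color is, up to sign, the [v]-coordinate of [x], which therefore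
    vanishes ([center_vert_coord]).  Hence [x] is a combination of labels.
    Every label is the color of some edge, and in a simple graph that edge is
    the only one between its ends, so the label is the bracket of those ends
    ([lie_edge_ends]). *)

Import GRing.Theory.
Local Open Scope ring_scope.

Section ColoredGraph.
Variable G : edge_labeled_digraph.
Implicit Types (v w : vert G) (e f : edge G).

Lemma joins_src_tgt e : joins e (src e) (tgt e).
Proof. by rewrite /joins !eqxx. Qed.

Lemma joins_endpointr e v w : joins e v w -> endpoint w e.
Proof. by rewrite /endpoint => /orP[/andP[_ /eqP->]|/andP[/eqP-> _]]; rewrite eqxx ?orbT. Qed.

Lemma joins_has_edge e v w :
  joins e v w -> has_edge v w (color e) || has_edge w v (color e).
Proof.
by case/orP=> evw; apply/orP; [left|right]; apply/existsP; exists e;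
  case/andP: evw => -> ->; rewrite eqxx.
Qed.

Lemma has_edge_joins v w z :
  has_edge v w z || has_edge w v z -> exists2 e, joins e v w & color e = z.
Proof.
by case/orP=> /existsP[e /and3P[es et /eqP ez]]; exists e; rewrite // /joins es et ?orbT.
Qed.

Lemma proper_endpoint_inj w e f : proper_coloring G ->
  endpoint w e -> endpoint w f -> color e = color f -> e = f.
Proof.
move=> hproper we wf cef; apply/eqP/negPn/negP => nef.
have inc : incident e f by apply/existsP; exists w; rewrite we wf.
by have := hproper e f nef inc; rewrite cef eqxx.
Qed.

(** Some edge exists and has two distinct ends, one of which differs from [v];
    a path from [v] to that end starts with an edge at [v]. *)
Lemma simple_vertex_joined v : simple_digraph G -> exists e w, joins e v w.
Proof.
case=> noloop _; have /card_gt0P[z _] := label_gt0 G.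
have [e0 _] := color_surj z.
have [u uv] : exists u, u != v.
  have [eq_v|] := eqVneq (src e0) v; last by exists (src e0).
  by exists (tgt e0); rewrite -eq_v eq_sym noloop.
have /connectP[[|w p] /=] := digraph_connected v u.
  by move=> _ eq_uv; rewrite eq_uv eqxx in uv.
by case/andP=> /existsP[e evw] _ _; exists e, w.
Qed.

(** Otherwise a second edge of the same color would run backwards between the
    same ends; simplicity identifies it with the first, which is then a loop. *)
Lemma has_edge_asym v w z : simple_digraph G -> has_edge v w z -> ~~ has_edge w v z.
Proof.
case=> noloop simple /existsP[e /and3P[es et _]]; apply/existsP => -[f /and3P[fs ft _]].
have nvw : v != w by rewrite -(eqP es) -(eqP et) noloop.
have eq_ef : e = f by apply: (simple v w nvw); rewrite /joins ?es ?et ?fs ?ft ?orbT.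
by case/negP: nvw; rewrite -(eqP es) -(eqP fs) eq_ef.
Qed.

End ColoredGraph.

Section GraphLie.
Context {R : realType} {G : edge_labeled_digraph}.
Local Notation L := (graph_lie R G).
Implicit Types (v w : vert G) (z : label G) (x y : L).

Lemma graph_lie_ext x y : x.1 = y.1 -> x.2 =1 y.2 -> x = y.
Proof. by case: x y => [x1 x2] [y1 y2] /= -> /ffunP->. Qed.

Lemma basis_bracket_label v w z :
  (basis_bracket R v w).2 z = (has_edge v w z)%:R - (has_edge w v z)%:R.
Proof.
rewrite /basis_bracket (raddf_sum snd) sum_ffunE (bigD1 z) //= !ffunE eqxx.
rewrite big1 ?addr0; first by rewrite /GRing.scale /= mulr1.
by move=> t tz; rewrite !ffunE eq_sym (negPf tz) scaler0.
Qed.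

Lemma lie_vert_vec_label x w z :
  (lie x (vert_vec R w)).2 z =
  \sum_v x.1 v * ((has_edge v w z)%:R - (has_edge w v z)%:R).
Proof.
rewrite graph_lieE /graph_bracket (raddf_sum snd) sum_ffunE.
apply: eq_bigr => v _; rewrite (bigD1 w) //= big1 ?addr0 => [|u uw].
  by rewrite !ffunE eqxx mulr1 basis_bracket_label.
by rewrite ffunE (negPf uw) mulr0 scale0r.
Qed.

Lemma sum_label_vec x : x.1 = 0 -> x = \sum_z x.2 z *: label_vec R z.
Proof.
move=> x1; apply: graph_lie_ext => [|t].
  by rewrite x1 (raddf_sum fst) big1 // => z _; rewrite /= scaler0.
rewrite (raddf_sum snd) sum_ffunE (bigD1 t) //= !ffunE eqxx.
rewrite big1 ?addr0; first by rewrite /GRing.scale /= mulr1.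
by move=> z zt; rewrite !ffunE eq_sym (negPf zt) scaler0.
Qed.

(** In a simple graph no other edge joins the ends of [e], so a single term of
    the bracket survives. *)
Lemma lie_edge_ends (e : edge G) : simple_digraph G ->
  lie (vert_vec R (src e)) (vert_vec R (tgt e)) = label_vec R (color e).
Proof.
move=> hsimple; have [noloop simple] := hsimple.
have src_tgt : has_edge (src e) (tgt e) (color e).
  by apply/existsP; exists e; rewrite !eqxx.
rewrite lie_vert_vec; apply: graph_lie_ext => [|t]; first exact: basis_bracket1.
rewrite basis_bracket_label ffunE.
have [->|nt] := eqVneq t (color e).
  by rewrite src_tgt (negPf (has_edge_asym _ _ _ _ hsimple src_tgt)) subr0.
suff : ~~ (has_edge (src e) (tgt e) t || has_edge (tgt e) (src e) t).
  by rewrite negb_or => /andP[/negPf-> /negPf->]; rewrite subr0.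
apply: contra nt => /has_edge_joins[f joins_f <-].
by rewrite (simple _ _ (noloop e) e f (joins_src_tgt _ e) joins_f).
Qed.

(** Bracketing with a neighbor [w] of [v] isolates the coordinate at [v]: by
    properness only the edge between [v] and [w] has its color at [w]. *)
Lemma center_vert_coord x : simple_digraph G -> proper_coloring G ->
  x \in center L -> x.1 = 0.
Proof.
move=> hsimple hproper /centerP cx; apply/ffunP => v; rewrite ffunE.
have [e [w evw]] := simple_vertex_joined _ v hsimple.
have := lie_vert_vec_label x w (color e).
rewrite cx ffunE (bigD1 v) //= big1 ?addr0 => [/esym/eqP|u uv].
  rewrite mulf_eq0 => /orP[/eqP//|].
  case/orP: (joins_has_edge _ _ _ _ evw) => he;
    rewrite he (negPf (has_edge_asym _ _ _ _ hsimple he)).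
    by rewrite subr0 oner_eq0.
  by rewrite sub0r oppr_eq0 oner_eq0.
suff : ~~ (has_edge u w (color e) || has_edge w u (color e)).
  by rewrite negb_or => /andP[/negPf-> /negPf->]; rewrite subr0 mulr0.
apply: contra uv => /has_edge_joins[f fuw cfe].
have eq_fe : f = e.
  exact: (proper_endpoint_inj _ _ _ _ hproper (joins_endpointr _ _ _ _ fuw)
    (joins_endpointr _ _ _ _ evw) cfe).
rewrite {f cfe}eq_fe in fuw.
(* The mixed cases force [u = w = v]. *)
by apply/eqP; case/orP: evw fuw => /andP[/eqP ? /eqP ?] /orP[] /andP[/eqP ? /eqP ?];
  congruence.
Qed.

Lemma center_eq_derived : simple_digraph G -> proper_coloring G ->
  center L = derived L.
Proof.
move=> hsimple hproper; apply/eqP; rewrite eqEsubv; apply/andP; split.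
  apply/subvP => x cx; rewrite (sum_label_vec x (center_vert_coord _ hsimple hproper cx)).
  apply: memv_suml => z _; apply: memvZ.
  have [e <-] := color_surj z; rewrite -(lie_edge_ends e hsimple).
  by have /derivedP := subvv (derived L); apply.
apply/derivedP => x y; apply/centerP => u.
by rewrite !graph_lieE graph_bracketC graph_bracket2step oppr0.
Qed.

End GraphLie.

Theorem proposition6p2 (R : realType) (G : edge_labeled_digraph)
  (hsimple : simple_digraph G) (hproper : proper_coloring G) :
  no_abelian_factor R G.
Proof.
have center_derived := @center_eq_derived R G hsimple hproper.
split=> [|a [_ center_sum /directv_addP direct_a]].
  split; rewrite ?sub0v ?addv0 //.
  by apply/directv_addP; rewrite capv0.
have sub_a : (a <= derived (graph_lie R G))%VS.
  by rewrite -center_derived center_sum addvSr.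
by rewrite -direct_a; apply/capv_idPr.
Qed.
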